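(* Let $S$ be a $Y$-pin. Then the unfolded quiver $\tilde{Q}_S$ is embedded in the plane (i.e. when every arrow is drawn as a straight segment between its endpoints in $\mathbb{Z}^2\subset\mathbb{R}^2$, no two arrows cross). Therefore $Q_S$ can be embedded on a cylinder, and $Q_{n,S}$ can be embedded on a torus for all $n\ge1$.
   Context: Y-pin: a set $S=\{a,b,c,d\}$ of four distinct points of $\mathbb{Z}^2$, with coordinates $a=(a_1,a_2)$ etc., labelled so that $a_2\le b_2<c_2\le d_2$, and such that the vectors $b-a,c-a,d-a$ generate $\mathbb{Z}^2$. The quiver $Q_S$: let $l=c_2+d_2-a_2-b_2$ and $V=\mathbb{Z}\times\{0,1,\dots,l-1\}$. $Q_S$ has vertex set $V$ and arrows of six types, for $(i,j)\in V$: North: $(i,j)+d-a\to(i,j)$; South: $(i,j)+c-b\to(i,j)$; East: $(i,j)\to(i,j)+d-b$; West: $(i,j)\to(i,j)+c-a$ (these four are drawn whenever both endpoints lie in $V$); Northeast: $(i,j)+c-a\to(i,j)+c-b$, drawn only when it completes two oriented triangles, one with $(i,j)$ and one with $(i,j)+2c-a-b$ (i.e. both of these lie in $V$); Northwest: $(i,j)+d-b\to(i,j)+c-b$, drawn only when it completes two oriented triangles, one with $(i,j)$ and one with $(i,j)+c+d-2b$ (i.e. both of these lie in $V$). $Q_{n,S}$ is the quotient of $Q_S$ by translation by $(n,0)$. The unfolding $\tilde{Q}_S$: let $I\subset\mathbb{Z}^2$ be the subgroup generated by $c+d-a-b$; $V$ is a set of coset representatives for $I$. Define $\phi:\mathbb{Z}^2\to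 V$ by $\phi(i,j)\equiv(d-b)i+(a-d)j\pmod I$. Assign to arrow types the displacements North $(0,1)$, South $(0,-1)$, East $(1,0)$, West $(-1,0)$, Northeast $(1,1)$, Northwest $(-1,1)$. For an arrow $\alpha:u\to v$ of $Q_S$ and $\tilde u\in\phi^{-1}(u)$, the lift of $\alpha$ at $\tilde u$ is the arrow starting at $\tilde u$ with displacement given by the type of $\alpha$ (its target lies in $\phi^{-1}(v)$). $\tilde{Q}_S$ has vertex set $\mathbb{Z}^2$ and all lifts of all arrows of $Q_S$. *)

(* Defs.v *)
From HB Require Import structures.
From mathcomp Require Import all_boot all_order all_algebra.
From mathcomp Require Import all_classical all_reals all_analysis.
From mathcomp Require Import zify ring.

Set Implicit Arguments.
Unset Strict Implicit.
Unset Printing Implicit Defensive.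

Import Order.TTheory GRing.Theory Num.Theory.
Import numFieldNormedType.Exports.

Local Open Scope classical_set_scope.
Local Open Scope ring_scope.
Local Open Scope quotient_scope.

Notation Z2 := (int * int)%type.

Record quiver := Quiver {
  vertex : Type;
  arrow : Type;
  source : arrow -> vertex;
  target : arrow -> vertex }.

(** The 1-dimensional CW complex of a quiver: one 0-cell per vertex, one open
    1-cell per arrow (loops and multiple arrows are allowed). *)
Inductive realization (R : realType) (Q : quiver) :=
| VertexPoint of vertex Q
| ArrowPoint of arrow Q & {t : R | 0 < t < 1}.
Arguments VertexPoint R {Q}.
Arguments ArrowPoint {R Q}.

HB.instance Definition _ (R : realType) (Q : quiver) :=
  gen_eqMixin (realization R Q).
HB.instance Definition _ (R : realType) (Q : quiver) :=
  gen_choiceMixin (realization R Q).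

(** The characteristic map of the closed 1-cell of [e]; only its values on
    [[0, 1]] are meaningful. *)
Definition arrow_path (R : realType) (Q : quiver) (e : arrow Q) (t : R) :
    realization R Q :=
  if insub t is Some t' then ArrowPoint e t'
  else if t <= 0 then VertexPoint R (source e) else VertexPoint R (target e).

(** CW (final) topology: a set is open iff its trace on each closed 1-cell is
    relatively open in [[0, 1]]; 0-cells impose no condition. *)
Definition realization_open (R : realType) (Q : quiver)
    (U : set (realization R Q)) :=
  forall e : arrow Q,
    open (arrow_path e @^-1` U : set (subspace (`[0, 1]%classic : set R))).

Lemma realization_openT (R : realType) (Q : quiver) :
  realization_open [set: realization R Q].
Proof. by move=> e; rewrite preimage_setT; exact: openT. Qed.

Lemma realization_openI (R : realType) (Q : quiver) :
  setI_closed (@realization_open R Q).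
Proof. by move=> A B oA oB e; rewrite preimage_setI; exact: openI. Qed.

Lemma realization_open_bigU (R : realType) (Q : quiver) (I : Type)
    (f : I -> set (realization R Q)) :
  (forall i, realization_open (f i)) -> realization_open (\bigcup_i f i).
Proof.
by move=> of_ e; rewrite preimage_bigcup; apply: bigcup_open => i _; exact: of_.
Qed.

HB.instance Definition _ (R : realType) (Q : quiver) :=
  @isOpenTopological.Build (realization R Q) (@realization_open R Q)
    (@realization_openT R Q) (@realization_openI R Q)
    (@realization_open_bigU R Q).

Definition topological_embedding (X Y : topologicalType) (f : X -> Y) :=
  [/\ injective f, continuous f &
      forall U : set X, open U -> exists2 W : set Y, open W & f @^-1` W = U].

(** [M] carries the subspace topology of [Y]. *)
Definition embeds_in (R : realType) (Q : quiver) (Y : topologicalType)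
    (M : set Y) :=
  exists2 f : realization R Q -> Y,
    topological_embedding f & range f `<=` M.

Definition circle (R : realType) : set (R * R) :=
  [set p | p.1 ^+ 2 + p.2 ^+ 2 = 1].
Arguments circle : clear implicits.

Definition cylinder (R : realType) : set ((R * R) * R) :=
  circle R `*` [set: R].
Arguments cylinder : clear implicits.

Definition torus (R : realType) : set ((R * R) * (R * R)) :=
  circle R `*` circle R.
Arguments torus : clear implicits.

Definition segment_point (R : realType) (p q : R * R) (t : R) : R * R :=
  ((1 - t) * p.1 + t * q.1, (1 - t) * p.2 + t * q.2).

Definition segment (R : realType) (p q : R * R) : set (R * R) :=
  segment_point p q @` `[0, 1].

Definition straight_drawing (R : realType) (Q : quiver)
    (pos : vertex Q -> R * R) (x : realization R Q) : R * R :=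
  match x with
  | VertexPoint v => pos v
  | ArrowPoint e t => segment_point (pos (source e)) (pos (target e)) (val t)
  end.

Definition straight_line_embedding (R : realType) (Q : quiver)
    (pos : vertex Q -> R * R) :=
  @topological_embedding (realization R Q) (R * R)%type (straight_drawing pos).
Arguments straight_line_embedding {R} Q pos.

(** Distinct arrows meet at most at common endpoints; in particular two arrows
    with overlapping segments, such as a 2-cycle, are forbidden. *)
Definition no_crossing (R : realType) (Q : quiver) (pos : vertex Q -> R * R) :=
  forall e e' : arrow Q, e <> e' ->
    segment (pos (source e)) (pos (target e)) `&`
    segment (pos (source e')) (pos (target e')) `<=`
    [set pos (source e); pos (target e)] `&`
    [set pos (source e'); pos (target e')].
Arguments no_crossing {R} Q pos.

Record Ypin := MkYpin {
  pa : Z2; pb : Z2; pc : Z2; pd : Z2;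
  Ypin_distinct : uniq [:: pa; pb; pc; pd];
  Ypin_ab : pa.2 <= pb.2;
  Ypin_bc : pb.2 < pc.2;
  Ypin_cd : pc.2 <= pd.2;
  Ypin_generate : forall p : Z2, inIntSpan [tuple pb - pa; pc - pa; pd - pa] p }.

Section YpinQuivers.
Variable S : Ypin.
Local Notation a := (pa S).
Local Notation b := (pb S).
Local Notation c := (pc S).
Local Notation d := (pd S).

Definition height : int := c.2 + d.2 - a.2 - b.2.

Definition in_strip (p : Z2) : bool := 0 <= p.2 < height.

Definition strip := {p : Z2 | in_strip p}.

Definition strip_point (p : Z2) (pS : in_strip p) : strip :=
  exist (fun p => is_true (in_strip p)) p pS.

End YpinQuivers.

Inductive direction := North | South | East | West | Northeast | Northwest.

HB.instance Definition _ := gen_eqMixin direction.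
HB.instance Definition _ := gen_choiceMixin direction.

Section StripQuiver.
Variable S : Ypin.
Local Notation a := (pa S).
Local Notation b := (pb S).
Local Notation c := (pc S).
Local Notation d := (pd S).

(** [p] is the point [(i, j)] in the six families of arrows; it is not always an
    endpoint of the arrow. *)
Definition arrow_start (k : direction) (p : Z2) : Z2 :=
  match k with
  | North => p + d - a
  | South => p + c - b
  | East => p
  | West => p
  | Northeast => p + c - a
  | Northwest => p + d - b
  end.

Definition arrow_end (k : direction) (p : Z2) : Z2 :=
  match k with
  | North => p
  | South => p
  | East => p + d - b
  | West => p + c - a
  | Northeast => p + c - b
  | Northwest => p + c - b
  end.

(** A diagonal arrow is the common side of two triangles, whose third vertices
    are [p] and the point below. *)
Definition drawn (kp : direction * Z2) : bool :=
  let: (k, p) := kp in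
  [&& in_strip S p, in_strip S (arrow_start k p), in_strip S (arrow_end k p) &
   match k with
   | Northeast => in_strip S (p + c *+ 2 - a - b)
   | Northwest => in_strip S (p + c + d - b *+ 2)
   | _ => true
   end].

Definition strip_arrow := {kp : direction * Z2 | drawn kp}.

Definition arrow_type (e : strip_arrow) : direction := (val e).1.

Lemma arrow_start_in_strip (e : strip_arrow) :
  in_strip S (arrow_start (val e).1 (val e).2).
Proof. by case: e => -[k p] /= /and4P[]. Qed.

Lemma arrow_end_in_strip (e : strip_arrow) :
  in_strip S (arrow_end (val e).1 (val e).2).
Proof. by case: e => -[k p] /= /and4P[]. Qed.

Definition strip_quiver : quiver := {|
  vertex := strip S;
  arrow := strip_arrow;
  source := fun e => strip_point (arrow_start_in_strip e);
  target := fun e => strip_point (arrow_end_in_strip e) |}.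

Definition same_orbit (n : nat) (p q : Z2) : bool :=
  `[< exists k : int, q = p + (n%:Z, 0) *~ k >].

Lemma same_orbit_refl n : reflexive (same_orbit n).
Proof. by move=> p; apply/asboolP; exists 0; rewrite mulr0z addr0. Qed.

Lemma same_orbit_sym n : symmetric (same_orbit n).
Proof.
move=> p q; apply/asboolP/asboolP => -[k ->]; exists (- k);
  by rewrite mulrNz addrK.
Qed.

Lemma same_orbit_trans n : transitive (same_orbit n).
Proof.
move=> q p r /asboolP[k ->] /asboolP[k' ->]; apply/asboolP.
by exists (k + k'); rewrite mulrzDr addrA.
Qed.

Definition vertex_orbit (n : nat) (u v : strip S) : bool :=
  same_orbit n (val u) (val v).

Definition arrow_orbit (n : nat) (e e' : strip_arrow) : bool :=
  ((val e).1 == (val e').1) && same_orbit n (val e).2 (val e').2.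

Lemma vertex_orbit_refl n : reflexive (vertex_orbit n).
Proof. by move=> u; exact: same_orbit_refl. Qed.

Lemma vertex_orbit_sym n : symmetric (vertex_orbit n).
Proof. by move=> u v; exact: same_orbit_sym. Qed.

Lemma vertex_orbit_trans n : transitive (vertex_orbit n).
Proof. by move=> v u w; exact: same_orbit_trans. Qed.

Canonical vertex_orbit_equiv n := EquivRel (vertex_orbit n)
  (vertex_orbit_refl n) (vertex_orbit_sym n) (@vertex_orbit_trans n).

Lemma arrow_orbit_refl n : reflexive (arrow_orbit n).
Proof. by move=> e; rewrite /arrow_orbit eqxx same_orbit_refl. Qed.

Lemma arrow_orbit_sym n : symmetric (arrow_orbit n).
Proof. by move=> e e'; rewrite /arrow_orbit eq_sym same_orbit_sym. Qed.

Lemma arrow_orbit_trans n : transitive (arrow_orbit n).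
Proof.
move=> e' e e'' /andP[/eqP kk pp] /andP[/eqP kk' pp'].
by rewrite /arrow_orbit kk kk' eqxx (same_orbit_trans pp pp').
Qed.

Canonical arrow_orbit_equiv n := EquivRel (arrow_orbit n)
  (arrow_orbit_refl n) (arrow_orbit_sym n) (@arrow_orbit_trans n).

(** [repr] is harmless in the endpoints of an orbit: see [quotient_source] and
    [quotient_target]. *)
Definition quotient_quiver (n : nat) : quiver := {|
  vertex := {eq_quot vertex_orbit_equiv n};
  arrow := {eq_quot arrow_orbit_equiv n};
  source := fun E => \pi_{eq_quot vertex_orbit_equiv n}
    (@source strip_quiver (repr E));
  target := fun E => \pi_{eq_quot vertex_orbit_equiv n}
    (@target strip_quiver (repr E)) |}.

Lemma same_orbit_shift n (p q v : Z2) :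
  same_orbit n p q -> same_orbit n (p + v) (q + v).
Proof. by move=> /asboolP[k ->]; apply/asboolP; exists k; rewrite addrAC. Qed.

Lemma quotient_source n (e : strip_arrow) :
  @source (quotient_quiver n) (\pi_{eq_quot arrow_orbit_equiv n} e) =
  \pi_{eq_quot vertex_orbit_equiv n} (@source strip_quiver e).
Proof.
apply/eqmodP; rewrite /= /vertex_orbit /=.
case: piP => e' /eqmodP; rewrite /= /arrow_orbit => /andP[/eqP -> oe].
rewrite same_orbit_sym; case: (val e').1 => //=;
  by rewrite -?addrA; do ?apply: same_orbit_shift.
Qed.

Lemma quotient_target n (e : strip_arrow) :
  @target (quotient_quiver n) (\pi_{eq_quot arrow_orbit_equiv n} e) =
  \pi_{eq_quot vertex_orbit_equiv n} (@target strip_quiver e).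
Proof.
apply/eqmodP; rewrite /= /vertex_orbit /=.
case: piP => e' /eqmodP; rewrite /= /arrow_orbit => /andP[/eqP -> oe].
rewrite same_orbit_sym; case: (val e').1 => //=;
  by rewrite -?addrA; do ?apply: same_orbit_shift.
Qed.

Definition I_gen : Z2 := c + d - a - b.

(** The representative in the strip of the class of [p] modulo [I]: the second
    coordinate of [I_gen] is [height S]. *)
Definition reduce (p : Z2) : Z2 := p - I_gen *~ (p.2 %/ height S)%Z.

Lemma height_gt0 : 0 < height S.
Proof.
rewrite /height; have := Ypin_ab S; have := Ypin_bc S; have := Ypin_cd S; lia.
Qed.

Lemma pair_mulrz (p : Z2) (k : int) : p *~ k = (p.1 * k, p.2 * k).
Proof.
rewrite -!mulrzz [LHS]surjective_pairing.
by congr pair; [exact: (raddfMz fst) | exact: (raddfMz snd)].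
Qed.

Lemma reduce_in_strip (p : Z2) : in_strip S (reduce p).
Proof.
have h0 := height_gt0; rewrite /in_strip.
have -> : (reduce p).2 = (p.2 %% height S)%Z.
  by rewrite /reduce pair_mulrz /= /modz mulrC.
by rewrite modz_ge0 ?ltz_pmod // gt_eqF.
Qed.

Definition phi (ij : Z2) : strip S :=
  strip_point (reduce_in_strip ((d - b) *~ ij.1 + (a - d) *~ ij.2)).

Definition displacement (k : direction) : Z2 :=
  match k with
  | North => (0, 1)
  | South => (0, -1)
  | East => (1, 0)
  | West => (-1, 0)
  | Northeast => (1, 1)
  | Northwest => (-1, 1)
  end.

(** The pair [(u, e)] is the lift of [e] at [u]. *)
Definition lifted_arrow :=
  {ue : Z2 * strip_arrow | phi ue.1 == @source strip_quiver ue.2}.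

Definition unfolded_quiver : quiver := {|
  vertex := Z2;
  arrow := lifted_arrow;
  source := fun l => (val l).1;
  target := fun l => (val l).1 + displacement (arrow_type (val l).2) |}.

Lemma reduce_shift (p : Z2) (k : int) : reduce (p + I_gen *~ k) = reduce p.
Proof.
rewrite /reduce [X in _ - I_gen *~ X](_ : _ = (p.2 %/ height S)%Z + k).
  by rewrite mulrzDr opprD addrACA subrr addr0.
rewrite pair_mulrz -[(p + _).2]/(p.2 + height S * k) [height S * k]mulrC.
by rewrite addrC divzMDl 1?addrC // gt_eqF // height_gt0.
Qed.

Lemma reduce_id (p : Z2) : in_strip S p -> reduce p = p.
Proof.
move=> /andP[p0 ph].
by rewrite /reduce divz_small ?mulr0z ?subr0 // p0 gtz0_abs ?height_gt0.
Qed.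

Lemma phi_lift_target (u : Z2) (e : strip_arrow) :
  phi u = @source strip_quiver e ->
  phi (u + displacement (arrow_type e)) = @target strip_quiver e.
Proof.
move=> /(congr1 val) /= eu; apply: val_inj; rewrite /=.
have := arrow_end_in_strip e; have := arrow_start_in_strip e.
move=> /reduce_id _ /reduce_id <-.
pose m : Z2 -> int := fun p => (p.2 %/ height S)%Z.
move: eu; rewrite /reduce -/(m _).
set w := (d - b) *~ u.1 + _ => /(canRL (subrK _)) eu.
have [k ek] : exists k : int,
    (d - b) *~ (u + displacement (arrow_type e)).1 +
    (a - d) *~ (u + displacement (arrow_type e)).2 =
    arrow_end (val e).1 (val e).2 + I_gen *~ k.
  have -> : (d - b) *~ (u + displacement (arrow_type e)).1 +
    (a - d) *~ (u + displacement (arrow_type e)).2 =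
    w + ((d - b) *~ (displacement (arrow_type e)).1 +
    (a - d) *~ (displacement (arrow_type e)).2).
    by rewrite !mulrzDr addrACA.
  rewrite eu /arrow_type /=; case: (sval e) => -[] p;
    [exists (m w) | exists (m w + 1) | exists (m w) | exists (m w - 1)
     | exists (m w) | exists (m w - 1)];
    rewrite /= /I_gen !pair_mulrz;
    apply/eqP; rewrite -subr_eq0; apply/eqP;
    rewrite [LHS]surjective_pairing /=; congr pair => /=; ring.
rewrite ek.
exact: (etrans (reduce_shift _ _)).
Qed.

End StripQuiver.

Definition lattice_point (R : realType) (p : Z2) : R * R := (p.1%:~R, p.2%:~R).
Arguments lattice_point : clear implicits.

(* Main.v *)
Require Import Defs.
From HB Require Import structures.
From mathcomp Require Import all_boot all_order all_algebra.
From mathcomp Require Import all_classical all_reals all_analysis.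
From mathcomp Require Import zify ring lra.
Import numFieldNormedType.Exports.
Import Order.TTheory GRing.Theory Num.Theory.

(** Every arrow of the unfolded quiver is a side or a diagonal of a unit square, so
    two arrows can cross only if they are opposite arrows on the same side or the
    two diagonals of the same square; both are excluded by comparing second
    coordinates in the strip. The quivers on the strip and on its quotients are the
    quotients of the unfolded quiver by the lattices of translations generated by
    [period], resp. by [period] and [n xi], where [xi] unfolds [(1, 0)]: projecting
    the straight-line drawing along [x = s period + t xi |-> (exp (2 pi i s), t)],
    resp. [(exp (2 pi i s), exp (2 pi i t / n))], embeds them. Local finiteness makes
    the drawings homeomorphisms onto their images. *)

Set Implicit Arguments.
Unset Strict Implicit.
Unset Printing Implicit Defensive.

Local Open Scope classical_set_scope.
Local Open Scope ring_scope.

(** * A criterion for topological embeddings of realizations *)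

Lemma realization_openE (R : realType) (Q : quiver) (U : set (realization R Q)) :
  open U = realization_open U.
Proof. by []. Qed.

Section EmbeddingCriterion.
Context {R : realType} {Q : quiver} {Y : topologicalType}.
Variables (f : realization R Q -> Y) (g : arrow Q -> R -> Y).
Hypothesis hausdorffY : hausdorff_space Y.
Hypothesis g_cont : forall e, continuous (g e).
Hypothesis fE : forall e (t : R), 0 <= t <= 1 -> f (arrow_path e t) = g e t.

Lemma continuous_along_arrows : continuous f.
Proof.
apply/continuousP => W oW; rewrite realization_openE => e.
apply/open_subspaceP; exists (g e @^-1` W).
  by apply: open_comp => // t _; exact: g_cont.
by apply/seteqP; split=> t [] /= + t01; rewrite fE.
Qed.

(** The parameters of a closed arrow that avoid an open set form a compact subset of [[0, 1]], and
    compact images in a Hausdorff space are closed. *)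
Lemma closed_arrow_image (e : arrow Q) (U : set (realization R Q)) :
  open U ->
  closed (g e @` [set t | 0 <= t <= 1 /\ ~ U (arrow_path e t)]).
Proof.
move=> oU; apply: compact_closed => //; apply: continuous_compact.
  by apply: continuous_subspaceT; exact: g_cont.
move: oU; rewrite realization_openE => /(_ e)/open_subspaceP[V oV VU].
rewrite [X in compact X](_ : _ = `[0, 1]%classic `&` ~` V).
  by apply: compact_closedI; [exact: segment_compact | exact: open_closedC].
have VUE t : 0 <= t <= 1 -> V t <-> U (arrow_path e t).
  move=> t01; split=> h.
    by have []// : ((arrow_path e @^-1` U) `&` `[0, 1]%classic) t;
      rewrite -VU; split.
  by have []// : (V `&` `[0, 1]%classic) t; rewrite VU; split.
apply/seteqP; split=> t /=; rewrite in_itv /= => -[t01 +];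
  by split=> //; rewrite ?VUE// -VUE.
Qed.

Lemma arrow_pathK (e : arrow Q) (t : {t : R | 0 < t < 1}) :
  arrow_path e (val t) = ArrowPoint e t.
Proof. by rewrite /arrow_path valK. Qed.

(** [f] need not be proper: it is enough that, locally in [Y], only finitely many
    cells are met, since finitely many compact pieces of arrows form a closed
    set. *)
Lemma locally_finite_embedding :
    injective f ->
    (forall y : Y, exists2 N : set Y, nbhs y N &
       finite_set [set v | N (f (VertexPoint R v))] /\
       finite_set [set e | exists2 t, 0 <= t <= 1 & N (g e t)]) ->
  topological_embedding f.
Proof.
move=> f_inj lfin; split=> //; first exact: continuous_along_arrows.
move=> U oU.
(* With the largest candidate it suffices to find, for each [x] in [U], one open [W] around [f x]
   whose preimage lies in [U]. *)
exists (\bigcup_(W in [set W : set Y | open W /\ f @^-1` W `<=` U]) W).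
  by apply: bigcup_open => W [].
apply/seteqP; split=> x; first by case=> W [_ WU] fxW; exact: WU.
move=> Ux; have [N Nfx [finV finA]] := lfin (f x).
pose Av := [set v | N (f (VertexPoint R v)) /\ ~ U (VertexPoint R v)].
pose Ae := [set e | exists2 t, 0 <= t <= 1 & N (g e t)].
pose Ce e := g e @` [set t | 0 <= t <= 1 /\ ~ U (arrow_path e t)].
(* [C] contains every point of [N] that is the image of a point outside [U]; removing it from the
   interior of [N] gives the required [W]. *)
pose C := (\bigcup_(v in Av) [set f (VertexPoint R v)]) `|` \bigcup_(e in Ae) Ce e.
have clC : closed C.
  apply: closedU.
  - apply: (@closed_bigcup _ {classic vertex Q}).
      by apply: sub_finite_set finV => v [].
    by move=> v _; apply: accessible_closed_set1; exact: hausdorff_accessible.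
  - apply: (@closed_bigcup _ {classic arrow Q}) => // e _.
    exact: closed_arrow_image.
have oCN : open (~` C `&` N°) by apply: openI; [exact: closed_openC | exact: open_interior].
exists (~` C `&` N°) => /=.
  split=> // z [/= nC /interior_subset Nz]; apply: contrapT => nUz; apply: nC.
  case: z => [v|e t] in Nz nUz *; first by left; exists v.
  have t01 : 0 <= val t <= 1 by case/andP: (valP t) => /ltW-> /ltW->.
  have ft : f (ArrowPoint e t) = g e (val t) by rewrite -fE ?arrow_pathK.
  right; exists e; first by exists (val t); rewrite // -ft.
  by exists (val t) => //; split; rewrite ?arrow_pathK.
split=> // -[[v [_ nUv] /= fv]|[e _ [t [t01 nU]]]].
  by apply: nUv; rewrite -(f_inj _ _ fv).
by rewrite -fE// => /f_inj fx; apply: nU; rewrite fx.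
Qed.

End EmbeddingCriterion.

(** * The unfolding modulo [I] and the pairs of arrows it forbids *)

Section UnfoldingMap.
Variable S : Ypin.
Local Notation a := (pa S).
Local Notation b := (pb S).
Local Notation c := (pc S).
Local Notation d := (pd S).

Definition unfold_vec (x : Z2) : Z2 := (d - b) *~ x.1 + (a - d) *~ x.2.

Lemma unfold_vecE (x : Z2) : unfold_vec x =
  ((d.1 - b.1) * x.1 + (a.1 - d.1) * x.2, (d.2 - b.2) * x.1 + (a.2 - d.2) * x.2).
Proof. by rewrite /unfold_vec !pair_mulrz. Qed.

Lemma unfold_vecD (x y : Z2) : unfold_vec (x + y) = unfold_vec x + unfold_vec y.
Proof. by rewrite /unfold_vec !mulrzDr addrACA. Qed.

(** The strip meets each class modulo [I_gen] exactly once, so an equality in the strip amounts to a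
    congruence in the plane. *)
Lemma val_phiP (x p : Z2) : in_strip S p ->
  val (phi S x) = p <-> exists k : int, unfold_vec x = p + I_gen S *~ k.
Proof.
move=> pS; split=> [<-|[k xk]]; last first.
  by rewrite /= -/(unfold_vec x) xk reduce_shift reduce_id.
exists ((unfold_vec x).2 %/ height S)%Z.
by rewrite /= -/(unfold_vec x) /reduce subrK.
Qed.

Lemma phi_eqP (x y : Z2) :
  phi S x = phi S y <-> exists k : int, unfold_vec x = unfold_vec y + I_gen S *~ k.
Proof.
have := (val_phiP y (valP (phi S y))).1 erefl => -[k yk].
split=> [/(congr1 val) /(val_phiP _ (valP _)) [k' xk']|[k' xk']].
  by exists (k' - k); rewrite xk' yk mulrzBr addrACA addrN addr0.
apply/val_inj/(val_phiP _ (valP _)); exists (k + k').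
by rewrite mulrzDr addrA -yk.
Qed.

Definition arrow_at (k : direction) (u : Z2) :=
  exists2 e : strip_arrow S, arrow_type e = k & phi S u = @source (strip_quiver S) e.

Lemma arrow_atP (k : direction) (u : Z2) : arrow_at k u ->
  exists p : Z2, [/\ drawn S (k, p), val (phi S u) = arrow_start S k p
    & val (phi S (u + displacement k)) = arrow_end S k p].
Proof.
case=> e <- ue; exists (val e).2; rewrite -surjective_pairing.
by split; [exact: valP | rewrite ue | rewrite (phi_lift_target ue)].
Qed.

(** North and South arrows both strictly lower the second coordinate in the strip, so they cannot be
    inverse to each other. *)
Lemma no_2cycle_vertical (u : Z2) :
  arrow_at North u -> ~ arrow_at South (u + (0, 1)).
Proof.
move=> /arrow_atP[p [_ pu pv]] /arrow_atP[q [_ qv]].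
rewrite -addrA addr0 pu pv in qv *; move=> /(congr1 snd) /= pq.
have := congr1 snd qv; rewrite /= => qv'.
have := Ypin_ab S; have := Ypin_bc S; have := Ypin_cd S; lia.
Qed.

(** East and West arrows both strictly raise the second coordinate in the strip. *)
Lemma no_2cycle_horizontal (u : Z2) :
  arrow_at East u -> ~ arrow_at West (u + (1, 0)).
Proof.
move=> /arrow_atP[p [_ pu pv]] /arrow_atP[q [_ qv]].
rewrite -addrA addr0 pu pv in qv *; move=> /(congr1 snd) /= pq.
have := congr1 snd qv; rewrite /= => qv'.
have := Ypin_ab S; have := Ypin_bc S; have := Ypin_cd S; lia.
Qed.

(** The corners [u], [u + (1, 0)], [u + (1, 1)], [u + (0, 1)] of the square unfold
    [p + c - a], [p], [p + c - b], [p + 2c - a - b]. A second diagonal would thus go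
    up from [p] to [p + 2c - a - b], but Northwest arrows are translates of [c - d]. *)
Lemma no_crossing_diagonals (u : Z2) :
  arrow_at Northeast u -> ~ arrow_at Northwest (u + (1, 0)).
Proof.
move=> /arrow_atP[p [/and4P[pS startS _ belowS] pu _]] /arrow_atP[q [_ qv qw]].
have [k uk] := (val_phiP u startS).1 pu.
have v_p : val (phi S (u + (1, 0))) = p.
  (* The displacement [(1, 0)] unfolds to [d - b], which is [I_gen - (c - a)]. *)
  apply/(val_phiP _ pS); exists (k + 1).
  rewrite unfold_vecD uk !unfold_vecE /I_gen !pair_mulrz.
  by rewrite [LHS]surjective_pairing [RHS]surjective_pairing /=; congr pair => /=; ring.
have w_p : val (phi S (u + (1, 0) + displacement Northwest)) = p + c *+ 2 - a - b.
  apply/(val_phiP _ belowS); exists (k - 1).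
  rewrite !unfold_vecD uk !unfold_vecE /I_gen !pair_mulrz.
  by rewrite [LHS]surjective_pairing [RHS]surjective_pairing /=; congr pair => /=; ring.
move: qv qw; rewrite v_p w_p mulr2n => /(congr1 snd) /= pq /(congr1 snd) /= pq'.
have := Ypin_ab S; have := Ypin_bc S; have := Ypin_cd S; lia.
Qed.

End UnfoldingMap.

(** * Intersections of arrows in the plane *)

Section ArrowGeometry.
Variable R : realType.
Implicit Types (k : direction) (u : Z2) (t : R).

Definition along k u t : R * R :=
  (u.1%:~R + t * (displacement k).1%:~R, u.2%:~R + t * (displacement k).2%:~R).

(** A point of an arrow is a lattice point, [square k u], plus a point of
    [[0, 1[ x [0, 1[], [in_square k t]; taking integer parts separates the arrows
    that are not drawn in the same square. *)
Definition square k u : Z2 :=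
  match k with
  | North | East | Northeast => u
  | South => (u.1, u.2 - 1)
  | West | Northwest => (u.1 - 1, u.2)
  end.

Definition in_square k t : R * R :=
  match k with
  | North => (0, t) | South => (0, 1 - t) | East => (t, 0) | West => (1 - t, 0)
  | Northeast => (t, t) | Northwest => (1 - t, t)
  end.

Lemma along_square k u t : along k u t =
  ((square k u).1%:~R + (in_square k t).1, (square k u).2%:~R + (in_square k t).2).
Proof.
by case: k; rewrite /along /= ?intrB; congr pair;
   rewrite ?mulr0 ?mulr1 ?mulrN1 ?addr0 //; ring.
Qed.

Lemma along0 k u : along k u 0 = lattice_point R u.
Proof. by rewrite /along !mul0r !addr0. Qed.

Lemma along1 k u : along k u 1 = lattice_point R (u + displacement k).
Proof. by rewrite /along !mul1r -!intrD. Qed.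

Lemma alongD k u (v : Z2) t : along k (u + v) t =
  ((along k u t).1 + v.1%:~R, (along k u t).2 + v.2%:~R).
Proof. by rewrite /along /= !intrD; congr pair; ring. Qed.

Lemma int_frac_uniq (m m' : int) (x x' : R) : 0 <= x < 1 -> 0 <= x' < 1 ->
  m%:~R + x = m'%:~R + x' -> m = m' /\ x = x'.
Proof.
move=> x01 x01' e; have mm : m = m'.
  have : (m - m')%:~R < 1%:~R :> R by rewrite intrB; lra.
  have : (-1)%:~R < (m - m')%:~R :> R by rewrite intrB; lra.
  by rewrite !ltr_int; lia.
by split=> //; rewrite mm in e; exact: addrI e.
Qed.

Lemma in_square_bounds k t : 0 < t < 1 ->
  0 <= (in_square k t).1 < 1 /\ 0 <= (in_square k t).2 < 1.
Proof. by move=> t01; case: k => /=; split; lra. Qed.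

Lemma along_notin_lattice k u v t : 0 < t < 1 -> along k u t <> lattice_point R v.
Proof.
move=> t01; have [b1 b2] := in_square_bounds k t01.
rewrite along_square -[lattice_point R v]/(v.1%:~R, v.2%:~R) => -[].
rewrite -[X in _ = X]addr0 => /(int_frac_uniq b1) []; first by lra.
move=> _ e1; rewrite -[X in _ = X]addr0 => /(int_frac_uniq b2) []; first by lra.
by move=> _ e2; case: k b1 b2 e1 e2 => /= b1 b2 e1 e2; lra.
Qed.

Variable S : Ypin.

(** Meeting arrows have equal [square] and equal [in_square]. Among arrows of different types this
    leaves opposite arrows on one side and the two diagonals of one square, which the unfolding
    excludes. *)
Lemma along_inj k k' u u' t t' : arrow_at S k u -> arrow_at S k' u' ->
  0 < t < 1 -> 0 < t' < 1 -> along k u t = along k' u' t' ->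
  [/\ k = k', u = u' & t = t'].
Proof.
move=> ku ku' t01 t01'.
have [b1 b2] := in_square_bounds k t01; have [b1' b2'] := in_square_bounds k' t01'.
rewrite !along_square => -[/(int_frac_uniq b1 b1')[s1 e1]].
move=> /(int_frac_uniq b2 b2')[s2 e2] {b1 b2 b1' b2'}.
case: u u' ku ku' s1 s2 => [i j] [i' j'].
have NS := @no_2cycle_vertical S; have EW := @no_2cycle_horizontal S.
have XX := @no_crossing_diagonals S.
case: k k' e1 e2 => -[] /= e1 e2 ku ku' s1 s2; try lra;
  try by (split; [by [] | congr pair; lia | lra]).
- by case: (NS _ ku); have -> : (i, j) + (0, 1) = (i', j') by congr pair => /=; lia.
- by case: (NS _ ku'); have -> : (i', j') + (0, 1) = (i, j) by congr pair => /=; lia.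
- by case: (EW _ ku); have -> : (i, j) + (1, 0) = (i', j') by congr pair => /=; lia.
- by case: (EW _ ku'); have -> : (i', j') + (1, 0) = (i, j) by congr pair => /=; lia.
- by case: (XX _ ku); have -> : (i, j) + (1, 0) = (i', j') by congr pair => /=; lia.
- by case: (XX _ ku'); have -> : (i', j') + (1, 0) = (i, j) by congr pair => /=; lia.
Qed.

End ArrowGeometry.

(** * Drawings in quotients of the plane by translations *)

Lemma continuous_pair (X Y Z : topologicalType) (f : X -> Y) (g : X -> Z) :
  continuous f -> continuous g -> continuous (fun x => (f x, g x)).
Proof.
move=> fc gc x.
exact: (@cvg_pair _ _ _ _ (nbhs (f x)) (nbhs (g x)) _ _ _ _ _ (fc x) (gc x)).
Qed.

Section PeriodicDrawing.
Context {R : realType} {S : Ypin} {Q : quiver} {Y : topologicalType}.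
(** [P] is the quotient of the plane by a lattice of translations and [Phi] the
    induced quotient of the vertices of the unfolded quiver. *)
Variables (Phi : Z2 -> vertex Q) (lift : vertex Q -> Z2).
Variables (dir : arrow Q -> direction) (P : R * R -> Y).
Hypothesis hausdorffY : hausdorff_space Y.
Hypothesis liftK : cancel lift Phi.
Hypothesis arrow_uniq : forall e e' : arrow Q,
  source e = source e' -> dir e = dir e' -> e = e'.
Hypothesis arrow_lift : forall (e : arrow Q) u,
  Phi u = source e -> arrow_at S (dir e) u.
Hypothesis target_lift : forall (e : arrow Q) u,
  Phi u = source e -> Phi (u + displacement (dir e)) = target e.
Hypothesis P_cont : continuous P.
Hypothesis P_lattice : forall u v,
  Phi u = Phi v -> P (lattice_point R u) = P (lattice_point R v).
Hypothesis P_fiber : forall x y, P x = P y -> exists2 v : Z2,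
  y = (x.1 + v.1%:~R, x.2 + v.2%:~R) & forall u, Phi (u + v) = Phi u.
Hypothesis P_finite : forall y : Y, exists2 N : set Y, nbhs y N &
  finite_set [set v | exists2 r : R * R, `|r.1| <= 1 /\ `|r.2| <= 1 &
    N (P ((lift v).1%:~R + r.1, (lift v).2%:~R + r.2))].

(** Each arrow is drawn from the chosen lift of its source. It may end at a lift of its target other
    than the chosen one; the two agree only after [P]. *)
Definition periodic_drawing (z : realization R Q) : Y :=
  match z with
  | VertexPoint v => P (lattice_point R (lift v))
  | ArrowPoint e t => P (along (dir e) (lift (source e)) (val t))
  end.

Lemma periodic_drawing_arrow_path (e : arrow Q) (t : R) : 0 <= t <= 1 ->
  periodic_drawing (arrow_path e t) = P (along (dir e) (lift (source e)) t).
Proof.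
move=> t01; rewrite /arrow_path; case: insubP => [t' _ <- //|].
rewrite negb_and -!leNgt; have [t0 _|t0 /= t1] := leP t 0.
  have -> : t = 0 by lra.
  by rewrite along0.
have -> : t = 1 by lra.
by rewrite along1; apply: P_lattice; rewrite target_lift liftK.
Qed.

Lemma periodic_drawing_inj : injective periodic_drawing.
Proof.
have VA (u : Z2) e (t : {t : R | 0 < t < 1}) :
    P (lattice_point R u) <> P (along (dir e) (lift (source e)) (val t)).
  move=> /P_fiber[v]; rewrite /= -!intrD => e1 _.
  exact: (along_notin_lattice (v := u + v) (valP t) e1).
case=> [v|e t] [v'|e' t'] //=.
- move=> /P_fiber[w]; rewrite /lattice_point /= -!intrD.
  move=> -[/intr_inj e1 /intr_inj e2] Phi_w.
  by rewrite -(liftK v) -(liftK v') -(Phi_w (lift v)); congr (VertexPoint _ (Phi _));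
    rewrite [RHS]surjective_pairing e1 e2.
- by move/VA.
- by move/esym/VA.
- move=> /P_fiber[w + Phi_w]; rewrite -alongD => /esym tt.
  (* Translating by [w] makes the two arrows meet in the plane itself, without changing the vertex
     below the source. *)
  have Ps : Phi (lift (source e) + w) = source e by rewrite Phi_w liftK.
  have [kk ss {}tt] := along_inj (arrow_lift Ps) (arrow_lift (liftK _))
    (valP t) (valP t') tt.
  have ee : e = e' by apply: arrow_uniq => //; rewrite -Ps ss liftK.
  by rewrite ee; congr ArrowPoint; exact: val_inj.
Qed.

Lemma finite_direction (A : set direction) : finite_set A.
Proof.
apply: (sub_finite_set (B := [set` [:: North; South; East; West; Northeast; Northwest]])).
  by move=> k _; rewrite /= !inE; case: k; rewrite eqxx ?orbT.
exact: finite_seq.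
Qed.

(** An arrow stays in the box of radius 1 around the lift of its source, so [P_finite] bounds the
    sources of the arrows near [y]; source and direction then determine the arrow. *)
Lemma periodic_drawing_embedding : topological_embedding periodic_drawing.
Proof.
apply: (@locally_finite_embedding _ _ _ _
  (fun e t => P (along (dir e) (lift (source e)) t))) => //.
- move=> e t; apply: continuous_comp; last exact: P_cont.
  by apply: continuous_pair => {}t; apply: cvgD; try exact: cvg_cst;
    exact: mulrr_continuous.
- exact: periodic_drawing_arrow_path.
- exact: periodic_drawing_inj.
move=> y; have [N Ny fin] := P_finite y; exists N => //; split.
  apply: sub_finite_set fin => v Nv; exists (0, 0) => /=.
    by rewrite normr0 ler01.
  by rewrite !addr0.
pose sd (e : arrow Q) := (source e, dir e).
have sd_inj : injective sd by move=> e e' [ss dd]; exact: arrow_uniq.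
apply: sub_finite_set (finite_preimage (in2W sd_inj)
  (finite_setX fin (finite_direction setT))).
move=> e [t t01 Ne]; split=> //=.
exists (t * (displacement (dir e)).1%:~R, t * (displacement (dir e)).2%:~R) => //.
by case: (dir e) => /=; rewrite ?mulr0 ?mulr1 ?mulrN1 ?normrN ?normr0 ger0_norm; lra.
Qed.

End PeriodicDrawing.

(** * The unfolded quiver in the plane *)

Lemma finite_box (B : nat) : finite_set [set p : Z2 | `|p.1| <= B%:Z /\ `|p.2| <= B%:Z].
Proof.
apply: sub_finite_set (finite_image (fun p : nat * nat => (p.1%:Z - B%:Z, p.2%:Z - B%:Z))
  (finite_setX (finite_II (B + B).+1) (finite_II (B + B).+1))).
case=> i j /= [iB jB]; exists (absz (i + B%:Z), absz (j + B%:Z)) => /=; first by split; lia.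
by congr pair; lia.
Qed.

Section UnfoldedQuiver.
Variables (R : realType) (S : Ypin).
Local Notation unfolded := (unfolded_quiver S).

Definition unfolded_dir (l : arrow unfolded) : direction := arrow_type (val l).2.

Lemma segment_point_along (l : arrow unfolded) (t : R) :
  segment_point (lattice_point R (source l)) (lattice_point R (target l)) t =
  along (unfolded_dir l) (source l) t.
Proof. by rewrite /segment_point /along /= !intrD; congr pair; ring. Qed.

Lemma unfolded_arrow_at (l : arrow unfolded) : arrow_at S (unfolded_dir l) (source l).
Proof. by exists (val l).2 => //; exact/eqP/(valP l). Qed.

Lemma arrow_start_inj k : injective (arrow_start S k).
Proof. by move=> p q; case: k => //=; do ?move/addIr. Qed.

Lemma strip_arrow_uniq (e e' : strip_arrow S) :
  @source (strip_quiver S) e = @source (strip_quiver S) e' ->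
  arrow_type e = arrow_type e' -> e = e'.
Proof.
move=> /(congr1 val) /=; rewrite /arrow_type => + tt; rewrite tt => /arrow_start_inj pp.
by apply: val_inj; rewrite [LHS]surjective_pairing tt pp -surjective_pairing.
Qed.

Lemma unfolded_arrow_uniq (l l' : arrow unfolded) :
  source l = source l' -> unfolded_dir l = unfolded_dir l' -> l = l'.
Proof.
move=> ss /= tt; apply: val_inj.
have ee : (val l).2 = (val l').2.
  apply: strip_arrow_uniq => //.
  by rewrite -(eqP (valP l)) -(eqP (valP l')); congr (phi S _).
by rewrite [LHS]surjective_pairing [RHS]surjective_pairing ee; congr pair.
Qed.

(** Two interior points coincide only on the same arrow, and an interior point is never a lattice
    point; only meetings at endpoints of both arrows remain. *)
Lemma unfolded_no_crossing : no_crossing unfolded (lattice_point R).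
Proof.
move=> l l' ll' x [[t t01 <-]] [t' t01' /=]; rewrite !segment_point_along.
have endpoint (m : arrow unfolded) (r : R) : ~~ (0 < r < 1) -> `[0, 1]%classic r ->
    exists2 u, along (unfolded_dir m) (source m) r = lattice_point R u &
      [set lattice_point R (source m); lattice_point R (target m)]
        (along (unfolded_dir m) (source m) r).
  rewrite /= in_itv /= => r01' r01.
  have [->|->] : r = 0 \/ r = 1 by case: (ltP 0 r) r01' => /= ? ?; [right|left]; lra.
    by exists (source m); rewrite along0 //; left.
  by exists (target m); rewrite along1 //; right.
have [tI|/(endpoint l)/(_ t01)] := boolP (0 < t < 1);
  have [tI'|/(endpoint l')/(_ t01')] := boolP (0 < t' < 1).
- move=> /esym /(along_inj (unfolded_arrow_at l) (unfolded_arrow_at l') tI tI').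
  by move=> [tt ss _]; case: ll'; exact: unfolded_arrow_uniq.
- by move=> [u -> _] /esym/(along_notin_lattice tI).
- by move=> [u -> _] /(along_notin_lattice tI').
- by move=> [u' _ e'] [u _ e] tt; split => //; rewrite -tt.
Qed.

Lemma unfolded_straight_line_embedding :
  straight_line_embedding unfolded (lattice_point R).
Proof.
rewrite /straight_line_embedding.
(* The straight drawing is the periodic one for the trivial lattice. *)
have -> : @straight_drawing R unfolded (lattice_point R) =
    @periodic_drawing R unfolded _ id unfolded_dir id.
  by apply/funext => -[v|l t] //=; exact: segment_point_along.
apply: (@periodic_drawing_embedding R S unfolded (R * R)%type id id unfolded_dir id) => //.
- exact: unfolded_arrow_uniq.
- by move=> l u ->; exact: unfolded_arrow_at.
- by move=> l u ->.
- by move=> x; exact: cvg_id.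
- by move=> u v ->.
- by move=> x y ->; exists 0; rewrite ?addr0 -?surjective_pairing // => u; rewrite addr0.
move=> y; exists (ball y 1); first exact: nbhsx_ballx.
have near_bound (z r : R) (m : int) : `|r| <= 1 -> `|z - (m%:~R + r)| < 1 ->
    `|m%:~R| <= `|z| + 2.
  have := ler_norm z; have := ler_norm (- z).
  by rewrite normrN ler_norml ltr_norml ler_norml; lra.
pose B := (Num.truncn (`|y.1| + `|y.2| + 2)).+1.
have yB : `|y.1| + `|y.2| + 2 < B%:R by exact: truncnS_gt.
apply: sub_finite_set (finite_box B) => v [r [r1 r2]] [d1 d2].
have y1 := normr_ge0 y.1; have y2 := normr_ge0 y.2.
split; rewrite -(ler_int R) intr_norm.
  by have := near_bound _ _ _ r1 d1; lra.
by have := near_bound _ _ _ r2 d2; lra.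
Qed.

End UnfoldedQuiver.

(** * The circle as the quotient of the line by the integers *)

Section UnitCircle.
Variable R : realType.
Implicit Types x y : R.

Definition circle_point x : R * R := (cos (x * (pi *+ 2)), sin (x * (pi *+ 2))).

Lemma circle_point_circle x : circle R (circle_point x).
Proof. exact: cos2Dsin2. Qed.

Lemma circle_pointDz x (j : int) : circle_point (x + j%:~R) = circle_point x.
Proof.
have per_nat z (n : nat) : circle_point (z + n%:R) = circle_point z.
  rewrite /circle_point mulrDl mulr_natl.
  by rewrite (periodicn (@cosD2pi R)) (periodicn (@sinD2pi R)).
case: j => n; first exact: per_nat.
by rewrite -[in RHS](subrK n.+1%:R x) per_nat NegzE mulrNz.
Qed.

(** The fractional part [r] of [y - x] has [cos (2 pi r) = 1], hence [sin (pi r) = 0]; but this sine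
    is positive when [0 < r < 1]. *)
Lemma circle_point_eq x y :
  circle_point x = circle_point y -> exists j : int, y = x + j%:~R.
Proof.
move=> [cxy sxy]; exists (Num.floor (y - x)).
pose r := y - x - (Num.floor (y - x))%:~R.
have /andP[r0 r1] : 0 <= r < 1 by have := floor_itv (y - x); rewrite intrD /r; lra.
suff : r = 0 by rewrite /r; lra.
have cosr : cos (r * pi *+ 2) = 1.
  have := circle_pointDz (y - x) (- Num.floor (y - x)); rewrite mulrNz => -[+ _].
  rewrite -mulrnAr => ->; rewrite mulrBl cosB cxy sxy -!expr2; exact: cos2Dsin2.
have sinr : sin (r * pi) = 0.
  move: cosr; rewrite cos_mulr2n cos2sin2 => h; apply/eqP; rewrite -sqrf_eq0; apply/eqP; lra.
apply/eqP; rewrite eq_le r0 andbT leNgt; apply/negP => r_gt0.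
have : 0 < sin (r * pi).
  by apply: sin_gt0_pi; rewrite mulr_gt0 ?pi_gt0 //= gtr_pMl ?pi_gt0.
by rewrite sinr ltxx.
Qed.

Lemma circle_point_continuous : continuous circle_point.
Proof.
by apply: continuous_pair => x; apply: continuous_comp;
  [exact: mulrr_continuous | exact: continuous_cos
  | exact: mulrr_continuous | exact: continuous_sin].
Qed.

End UnitCircle.

(** * Coordinates adapted to the translation lattice *)

Lemma unfold_vec_onto (S : Ypin) (p : Z2) :
  exists (x : Z2) (k : int), unfold_vec S x + I_gen S *~ k = p.
Proof.
have [x ->] := Ypin_generate S p.
pose x0 := x ord0; pose x1 := x (lift ord0 ord0); pose x2 := x (lift ord0 (lift ord0 ord0)).
(* The generators of the [Y]-pin are [b - a = - (d - b) - (a - d)], [c - a = I_gen - (d - b)] and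
   [d - a = - (a - d)]. *)
exists (- x0 - x1, - x0 - x2), x1.
rewrite !big_ord_recl big_ord0 addr0 /= -/x0 -/x1 -/x2 unfold_vecE /I_gen !pair_mulrz.
by rewrite [LHS]surjective_pairing [RHS]surjective_pairing /=; congr pair => /=; ring.
Qed.

Lemma Z2_mulrz_snd (p : Z2) (k : int) : (p *~ k).2 = p.2 * k.
Proof. by rewrite pair_mulrz. Qed.

Lemma Z2_add_snd (p q : Z2) : (p + q).2 = p.2 + q.2.
Proof. by []. Qed.

(** Cramer's rule for the determinant with rows [(i, al, al')], [(j, be, be')],
    [(- k, g, g')]: its last row times [h] is [(0, 0, 1)] up to the other two rows. *)
Lemma third_coord_det (p q h i j k al be g al' be' g' : int) :
  p * i + q * j = h * k -> p * al + q * be + h * g = 0 ->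
  p * al' + q * be' + h * g' = 1 ->
  i * be - j * al =
  (i * (be * g' - g * be') + j * (g * al' - al * g') - k * (al * be' - be * al')) * h.
Proof.
move=> ek e1 e2.
(* Regrouped so that [h] occurs only in [h * k], [h * g] and [h * g'], which the hypotheses
   eliminate. *)
have -> : (i * (be * g' - g * be') + j * (g * al' - al * g')
    - k * (al * be' - be * al')) * h =
  i * (be * (h * g') - (h * g) * be') + j * ((h * g) * al' - al * (h * g'))
    - (h * k) * (al * be' - be * al') by ring.
rewrite -ek (canRL (addKr _) e1) (canRL (addKr _) e2); ring.
Qed.

Lemma unfold_vecMz (S : Ypin) (x : Z2) (k : int) :
  unfold_vec S (x *~ k) = unfold_vec S x *~ k.
Proof. by rewrite !unfold_vecE !pair_mulrz /=; congr pair; ring. Qed.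

Lemma unfold_vecB (S : Ypin) (x y : Z2) :
  unfold_vec S (x - y) = unfold_vec S x - unfold_vec S y.
Proof. by rewrite !unfold_vecE /=; congr pair => /=; ring. Qed.

Section LatticeCoordinates.
Variables (R : realType) (S : Ypin).
Local Notation a := (pa S).
Local Notation b := (pb S).
Local Notation c := (pc S).
Local Notation d := (pd S).
Local Notation h := (height S).
Local Notation w := (I_gen S).
Local Notation L := (unfold_vec S).

Variables (xi zeta : Z2) (g g' : int).
Hypothesis xiE : L xi + w *~ g = (1, 0).
Hypothesis zetaE : L zeta + w *~ g' = (0, 1).

(** [U] and [W] are the determinants of [d - b] and [a - d] against [I_gen]; thus
    [x.1 * U + x.2 * W] is that of [L x], and vanishes when [L x] is a multiple of [I_gen]. *)
Let U : int := (d.1 - b.1) * w.2 - (d.2 - b.2) * w.1.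
Let W : int := (a.1 - d.1) * w.2 - (a.2 - d.2) * w.1.

(** The generator of the kernel of [Z2 -> Z2 / I]: by Cramer's rule, its image is
    a multiple of [I_gen]. *)
Definition period : Z2 := (W, - U).

(** The coordinates of [x] in the basis [(period, xi)]. *)
Definition period_coord (x : R * R) : R := (x.1 * xi.2%:~R - x.2 * xi.1%:~R) / h%:~R.
Definition strip_coord (x : R * R) : R := (x.1 * U%:~R + x.2 * W%:~R) / h%:~R.

Lemma unfold_vec_fst (x : Z2) : (L x).1 = (d.1 - b.1) * x.1 + (a.1 - d.1) * x.2.
Proof. by rewrite unfold_vecE. Qed.

Lemma unfold_vec_snd (x : Z2) : (L x).2 = (d.2 - b.2) * x.1 + (a.2 - d.2) * x.2.
Proof. by rewrite unfold_vecE. Qed.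

Lemma heightR_neq0 : h%:~R != 0 :> R.
Proof. by rewrite intr_eq0 gt_eqF // height_gt0. Qed.

Lemma I_gen_snd : w.2 = h. Proof. by []. Qed.

Lemma Z2_eqP (x y : Z2) : x = y <-> x.1 = y.1 /\ x.2 = y.2.
Proof. by split=> [->//|[e1 e2]]; rewrite [x]surjective_pairing e1 e2 -surjective_pairing. Qed.

Lemma unfold_period : L period = w *~ - ((d.1 - b.1) * (a.2 - d.2) - (a.1 - d.1) * (d.2 - b.2)).
Proof. by apply/Z2_eqP; rewrite !unfold_vecE pair_mulrz /period /U /W /=; split; ring. Qed.

Lemma strip_coord_lattice (x : Z2) :
  strip_coord (lattice_point R x) = ((L x).1 * w.2 - (L x).2 * w.1)%:~R / h%:~R.
Proof.
rewrite /strip_coord unfold_vec_fst unfold_vec_snd /= -!intrM -intrD; congr (_%:~R / _).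
by rewrite /U /W /I_gen /=; ring.
Qed.

(** The second coordinates of the equations for [x], [xi] and [zeta] are the hypotheses of
    [third_coord_det], so [h] divides the numerator. *)
Lemma period_coord_int (x : Z2) (k : int) : L x = w *~ k ->
  exists j : int, period_coord (lattice_point R x) = j%:~R.
Proof.
move=> /Z2_eqP[_ xk]; have [/Z2_eqP[_ x1] /Z2_eqP[_ z1]] := (xiE, zetaE).
rewrite Z2_mulrz_snd unfold_vec_snd I_gen_snd in xk.
rewrite Z2_add_snd Z2_mulrz_snd unfold_vec_snd I_gen_snd in x1.
rewrite Z2_add_snd Z2_mulrz_snd unfold_vec_snd I_gen_snd in z1.
eexists; rewrite /period_coord [lattice_point R x]/lattice_point -!intrM -intrB.
by rewrite (third_coord_det xk x1 z1) intrM mulfK // heightR_neq0.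
Qed.

Lemma period_coordD (x y : R * R) :
  period_coord (x.1 + y.1, x.2 + y.2) = period_coord x + period_coord y.
Proof. by rewrite /period_coord /= -mulrDl; congr (_ / _); ring. Qed.

Lemma strip_coordD (x y : R * R) :
  strip_coord (x.1 + y.1, x.2 + y.2) = strip_coord x + strip_coord y.
Proof. by rewrite /strip_coord /= -mulrDl; congr (_ / _); ring. Qed.

Lemma lattice_pointB (u v : Z2) : lattice_point R u =
  ((lattice_point R v).1 + (lattice_point R (u - v)).1,
   (lattice_point R v).2 + (lattice_point R (u - v)).2).
Proof. by rewrite /lattice_point /= !intrD !intrN; congr pair; ring. Qed.

Lemma coords_of_congruent (u v : Z2) (k m : int) : L u = L v + (k, 0) + w *~ m ->
  (exists j : int, period_coord (lattice_point R u) =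
     period_coord (lattice_point R v) + j%:~R) /\
  strip_coord (lattice_point R u) = strip_coord (lattice_point R v) + k%:~R.
Proof.
move=> uv; rewrite (lattice_pointB u v) period_coordD strip_coordD; split.
  (* Subtracting [xi *~ k] cancels [(k, 0)] modulo [I], and leaves [period_coord] unchanged because
     it vanishes on [xi]. *)
  have [|j jE] := @period_coord_int (u - v - xi *~ k) (m + g * k).
    rewrite 2!unfold_vecB uv unfold_vecMz (canRL (addrK _) xiE).
    by apply/Z2_eqP; rewrite !pair_mulrz /=; split; ring.
  exists j; congr +%R; rewrite -jE /period_coord /= !pair_mulrz /= !intrB !intrM.
  by congr (_ / _); ring.
congr +%R; rewrite strip_coord_lattice unfold_vecB uv.
apply: (mulIf heightR_neq0); rewrite divfK ?heightR_neq0 // -intrM; congr _%:~R.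
by rewrite !pair_mulrz /height /=; ring.
Qed.

Lemma lattice_of_coords (x y : R * R) (j k : int) :
  period_coord y = period_coord x + j%:~R -> strip_coord y = strip_coord x + k%:~R ->
  exists2 v : Z2, y = (x.1 + v.1%:~R, x.2 + v.2%:~R) &
    exists m : int, L v = (k, 0) + w *~ m.
Proof.
move=> yj yk; exists (period *~ j + xi *~ k); last first.
  rewrite unfold_vecD !unfold_vecMz unfold_period (canRL (addrK _) xiE).
  exists (- ((d.1 - b.1) * (a.2 - d.2) - (a.1 - d.1) * (d.2 - b.2)) * j - g * k).
  by apply/Z2_eqP; rewrite !pair_mulrz /=; split; ring.
have h0 := heightR_neq0.
(* The determinant of the basis [(period, xi)]; it allows the two coordinate equations to be solved
   for [y - x]. *)
have det : (W * xi.2 + U * xi.1)%:~R = h%:~R :> R.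
  congr _%:~R; transitivity ((L xi).1 * w.2 - (L xi).2 * w.1).
    by rewrite unfold_vec_fst unfold_vec_snd /W /U /I_gen /=; ring.
  by rewrite (canRL (addrK _) xiE) pair_mulrz /height /=; ring.
have {}yj : (y.1 - x.1) * xi.2%:~R - (y.2 - x.2) * xi.1%:~R = j%:~R * h%:~R.
  apply: (mulIf (invr_neq0 h0)); rewrite mulfK //.
  by move: yj; rewrite /period_coord => /(canLR (addKr _)) <-; ring.
have {}yk : (y.1 - x.1) * U%:~R + (y.2 - x.2) * W%:~R = k%:~R * h%:~R.
  apply: (mulIf (invr_neq0 h0)); rewrite mulfK //.
  by move: yk; rewrite /strip_coord => /(canLR (addKr _)) <-; ring.
rewrite !pair_mulrz [LHS]surjective_pairing /= !intrD !intrM intrN.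
rewrite intrD !intrM in det.
congr pair.
  rewrite -[LHS](subrK x.1) [RHS]addrC; congr (_ + _); apply: (mulIf h0).
  transitivity (W%:~R * (j%:~R * h%:~R) + xi.1%:~R * (k%:~R * h%:~R) : R); last by ring.
  by rewrite -yj -yk -det; ring.
rewrite -[LHS](subrK x.2) [RHS]addrC; congr (_ + _); apply: (mulIf h0).
transitivity (- U%:~R * (j%:~R * h%:~R) + xi.2%:~R * (k%:~R * h%:~R) : R); last by ring.
by rewrite -yj -yk -det; ring.
Qed.

Definition strip_lift (p : Z2) : Z2 := xi *~ p.1 + zeta *~ p.2.

Lemma unfold_strip_lift (p : Z2) : exists m : int, L (strip_lift p) = p + w *~ m.
Proof.
exists (- (g * p.1 + g' * p.2)).
rewrite unfold_vecD !unfold_vecMz (canRL (addrK _) xiE) (canRL (addrK _) zetaE).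
by apply/Z2_eqP; rewrite !pair_mulrz /=; split; ring.
Qed.

Lemma phi_strip_lift (v : strip S) : phi S (strip_lift (val v)) = v.
Proof. exact/val_inj/(val_phiP _ (valP v))/unfold_strip_lift. Qed.

Lemma strip_coord_strip_lift (p : Z2) :
  strip_coord (lattice_point R (strip_lift p)) = p.1%:~R - p.2%:~R * w.1%:~R / h%:~R.
Proof.
have [m pm] := unfold_strip_lift p; rewrite strip_coord_lattice pm.
apply: (mulIf heightR_neq0); rewrite mulrBl !divfK ?heightR_neq0 // -!intrM -intrB.
by congr _%:~R; rewrite !pair_mulrz /height /=; ring.
Qed.

Lemma strip_coord_bounded : exists M : R, forall r : R * R,
  `|r.1| <= 1 -> `|r.2| <= 1 -> `|strip_coord r| <= M.
Proof.
exists (`|U%:~R / h%:~R| + `|W%:~R / h%:~R|) => r r1 r2.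
have -> : strip_coord r = r.1 * (U%:~R / h%:~R) + r.2 * (W%:~R / h%:~R).
  by rewrite /strip_coord; ring.
by apply: (le_trans (ler_normD _ _)); rewrite !(normrM r.1, normrM r.2) lerD ?ler_piMl.
Qed.

(** In the strip [p.2 / h] lies in [[0, 1[], so [strip_coord] of the lift differs from [p.1] by at
    most the absolute value of [w.1]. This gives local finiteness on the cylinder. *)
Lemma strip_coord_far (p : Z2) : in_strip S p ->
  `|p.1%:~R| <= `|strip_coord (lattice_point R (strip_lift p))| + `|w.1%:~R|.
Proof.
move=> /andP[p0 ph]; have h_gt0 : 0 < h%:~R :> R by rewrite ltr0z height_gt0.
have -> : p.1%:~R = strip_coord (lattice_point R (strip_lift p)) +
    p.2%:~R / h%:~R * w.1%:~R by rewrite strip_coord_strip_lift; ring.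
apply: (le_trans (ler_normD _ _)); rewrite lerD2l normrM ler_piMl //.
have ? : 0 <= p.2%:~R / h%:~R :> R by rewrite divr_ge0 ?ler0z // ltW ?height_gt0.
by rewrite ger0_norm // ler_pdivrMr // mul1r ler_int ltW.
Qed.

Lemma period_coord_continuous : continuous period_coord.
Proof.
move=> x; apply: cvgM; last exact: cvg_cst.
by apply: cvgB; apply: cvgM; (exact: cvg_cst || exact: cvg_fst || exact: cvg_snd).
Qed.

Lemma strip_coord_continuous : continuous strip_coord.
Proof.
move=> x; apply: cvgM; last exact: cvg_cst.
by apply: cvgD; apply: cvgM; (exact: cvg_cst || exact: cvg_fst || exact: cvg_snd).
Qed.

End LatticeCoordinates.

(** * The strip quiver on the cylinder *)

Section StripQuiver.
Variables (R : realType) (S : Ypin).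
Local Notation h := (height S).
Local Notation w := (I_gen S).
Local Notation L := (unfold_vec S).
Variables (xi zeta : Z2) (g g' : int).
Hypothesis xiE : L xi + w *~ g = (1, 0).
Hypothesis zetaE : L zeta + w *~ g' = (0, 1).
Local Notation pc := (@period_coord R S xi).
Local Notation sc := (@strip_coord R S).

Lemma finite_strip_box (B : nat) : finite_set [set v : strip S | `|(val v).1| <= B%:Z].
Proof.
pose B' := (B + absz h)%N.
have val_inj2 : {in val @^-1` [set p : Z2 | `|p.1| <= B'%:Z /\ `|p.2| <= B'%:Z] &,
    injective (val : strip S -> Z2)} by move=> ? ? _ _; exact: val_inj.
apply: sub_finite_set (finite_preimage val_inj2 (finite_box B')) => v vB.
by have := valP v; rewrite /in_strip /B' /= in vB * => ?; split; lia.
Qed.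

Definition cylinder_point (x : R * R) : (R * R) * R := (circle_point (pc x), sc x).

Lemma strip_embeds_in_cylinder : embeds_in R (strip_quiver S) (cylinder R).
Proof.
exists (@periodic_drawing R (strip_quiver S) _ (fun v => strip_lift xi zeta (val v))
  (@arrow_type S) cylinder_point); last first.
  by move=> _ [[v|e t] _ <-]; split => //; exact: circle_point_circle.
apply: (@periodic_drawing_embedding R S (strip_quiver S) _ (phi S)) => //.
- exact: (phi_strip_lift xiE zetaE).
- exact: strip_arrow_uniq.
- by move=> e u ue; exists e.
- by move=> e u; exact: phi_lift_target.
- apply: continuous_pair; last exact: strip_coord_continuous.
  move=> x; apply: continuous_comp; first exact: period_coord_continuous.
  exact: circle_point_continuous.
- move=> u v /phi_eqP[m uv]; rewrite /cylinder_point.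
  have [|[j ->] ->] := @coords_of_congruent R S xi zeta g g' xiE zetaE u v 0 m.
    by rewrite addr0.
  by rewrite circle_pointDz addr0.
- move=> x y xy; have /circle_point_eq[j yj] := congr1 fst xy.
  have [|v yv [m vm]] := lattice_of_coords xiE (k := 0) yj.
    by rewrite addr0; exact: esym (congr1 snd xy).
  exists v => // u; apply/phi_eqP; exists m.
  by rewrite unfold_vecD vm [(0, 0) + _]add0r.
move=> y; exists (ball y 1); first exact: nbhsx_ballx.
have [M M_bound] := @strip_coord_bounded R S.
(* [M] accounts for the offset [r], 1 for the radius of the ball, and the last term for
   [strip_coord_far]. *)
pose B := (Num.truncn (`|y.2| + M + 1 + `|w.1%:~R|)).+1.
have yB : `|y.2| + M + 1 + `|w.1%:~R| < B%:R by exact: truncnS_gt.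
apply: sub_finite_set (finite_strip_box B) => v [r [r1 r2]] [_ /=].
rewrite (@strip_coordD R S (lattice_point R (strip_lift xi zeta (val v)))).
rewrite /ball /= => near_y /=.
have far := @strip_coord_far R S _ _ _ _ xiE zetaE _ (valP v).
have rM := M_bound _ r1 r2.
rewrite -(ler_int R) intr_norm; apply: (le_trans far); apply: ltW.
apply: le_lt_trans yB; rewrite lerD2r.
move: near_y rM; set z := strip_coord _ _; set z' := strip_coord _ _.
rewrite ltr_norml ler_norml => /andP[? ?] /andP[? ?].
have := ler_norm y.2; have := ler_norm (- y.2); rewrite normrN.
by rewrite ler_norml; lra.
Qed.

End StripQuiver.

Local Open Scope quotient_scope.

(** * The quotient quivers on the torus *)

Section QuotientQuiver.
Variables (R : realType) (S : Ypin).
Local Notation h := (height S).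
Local Notation w := (I_gen S).
Local Notation L := (unfold_vec S).
Variables (xi zeta : Z2) (g g' : int) (n : nat).
Hypothesis xiE : L xi + w *~ g = (1, 0).
Hypothesis zetaE : L zeta + w *~ g' = (0, 1).
Hypothesis n_gt0 : (0 < n)%N.
Local Notation pc := (@period_coord R S xi).
Local Notation sc := (@strip_coord R S).
Local Notation Qn := (quotient_quiver S n).

Definition quotient_phi (u : Z2) : vertex Qn := \pi_(vertex Qn) (phi S u).

Definition quotient_lift (V : vertex Qn) : Z2 := strip_lift xi zeta (val (repr V)).

Definition quotient_dir (E : arrow Qn) : direction := arrow_type (repr E).

Lemma period_shift_fst (j : int) : (n%:Z, 0) *~ j = (n%:Z * j, 0) :> Z2.
Proof. by rewrite pair_mulrz mul0r. Qed.

Lemma quotient_liftK : cancel quotient_lift quotient_phi.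
Proof. by move=> V; rewrite /quotient_phi (phi_strip_lift xiE zetaE) reprK. Qed.

Lemma drawn_shift k (p : Z2) (m : int) : drawn S (k, p) -> drawn S (k, p + (m, 0)).
Proof. by case: k; rewrite /drawn /in_strip /= !addr0. Qed.

Lemma arrow_startD k (p v : Z2) : arrow_start S k (p + v) = arrow_start S k p + v.
Proof. by case: k => //=; rewrite -!addrA; congr (_ + _); rewrite addrC -!addrA. Qed.

(** The representative of [E] may start elsewhere in the orbit of [phi S u]. A translate by a
    multiple of [(n, 0)] starts at [phi S u], and is drawn since the strip conditions see only
    second coordinates. *)
Lemma quotient_arrow_lift (E : arrow Qn) (u : Z2) : quotient_phi u = source E ->
  exists2 e : strip_arrow S, \pi_(arrow Qn) e = E & phi S u = @source (strip_quiver S) e.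
Proof.
move=> /eqmodP /= /asboolP[j sE].
pose p := (val (repr E)).2; pose k := (val (repr E)).1.
have kp : drawn S (k, p + (- (n%:Z * j), 0)).
  by apply: drawn_shift; rewrite -surjective_pairing; exact: valP.
exists (exist (fun kp => is_true (drawn S kp)) _ kp).
  rewrite -[RHS]reprK; apply/eqmodP; rewrite /= /arrow_orbit /= eqxx.
  apply/asboolP; exists j; rewrite period_shift_fst.
  by rewrite -addrA [X in _ + X](_ : _ = 0) ?addr0 //; congr pair; rewrite /= ?addNr.
apply: val_inj; rewrite [RHS]/= arrow_startD -/p -/k.
have {}sE : arrow_start S k p = val (phi S u) + (n%:Z, 0) *~ j := sE.
rewrite sE period_shift_fst -addrA [X in _ + X](_ : _ = 0) ?addr0 //.
by congr pair; rewrite /= ?subrr.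
Qed.

Lemma quotient_dir_pi (e : strip_arrow S) : quotient_dir (\pi_(arrow Qn) e) = arrow_type e.
Proof. by rewrite /quotient_dir; case: piP => e' /eqmodP /andP[/eqP]. Qed.

Lemma quotient_arrow_uniq (E E' : arrow Qn) :
  source E = source E' -> quotient_dir E = quotient_dir E' -> E = E'.
Proof.
move=> ss dd.
have [e eE ue] := quotient_arrow_lift (quotient_liftK (source E)).
have [e' eE' ue'] := quotient_arrow_lift (etrans (quotient_liftK (source E)) ss).
rewrite -eE -eE' !quotient_dir_pi in dd *; congr (\pi_(arrow Qn) _).
by apply: strip_arrow_uniq => //; rewrite -ue -ue'.
Qed.

Lemma quotient_phi_eqP (u v : Z2) : quotient_phi u = quotient_phi v <->
  exists k m : int, L u = L v + (n%:Z * k, 0) + w *~ m.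
Proof.
have [m vm] := (val_phiP v (valP (phi S v))).1 erefl.
have shiftS k : in_strip S (val (phi S v) + (n%:Z * k, 0)).
  by have := valP (phi S v); rewrite /in_strip /= addr0.
have phi_shift k : val (phi S u) = val (phi S v) + (n%:Z * k, 0) <->
    exists m' : int, L u = L v + (n%:Z * k, 0) + w *~ m'.
  split=> [/(val_phiP _ (shiftS k))[m' um]|[m' um]].
    by exists (m' - m); rewrite um vm mulrzBr; apply/Z2_eqP => /=; split; ring.
  apply/(val_phiP _ (shiftS k)); exists (m + m').
  by rewrite um vm mulrzDr; apply/Z2_eqP => /=; split; ring.
split=> [/eqmodP|[k]] /=.
  rewrite /= /vertex_orbit same_orbit_sym => /asboolP[k].
  by rewrite period_shift_fst => /phi_shift[m']; exists k, m'.
move=> /phi_shift uv; apply/eqmodP; rewrite /= /vertex_orbit same_orbit_sym.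
by apply/asboolP; exists k; rewrite period_shift_fst.
Qed.

(** Reducing the first coordinate modulo [n] brings every orbit into a finite box. *)
Lemma finite_quotient_vertices : finite_set [set: vertex Qn].
Proof.
apply: sub_finite_set (finite_image (fun v => \pi_(vertex Qn) v) (finite_strip_box S n)).
move=> V _; pose p := val (repr V); pose j := (p.1 %/ n)%Z.
have pS : in_strip S ((p.1 %% n)%Z, p.2) by exact: (valP (repr V)).
exists (strip_point pS) => /=.
  by rewrite ger0_norm ?modz_ge0 // ?ltW ?ltz_pmod // -lt0n.
rewrite -[RHS]reprK; apply/eqmodP/asboolP; exists j.
rewrite period_shift_fst -/p [LHS]surjective_pairing /=.
by congr pair; rewrite /= ?addr0 // {1}(divz_eq p.1 n) -/j; ring.
Qed.

Definition torus_point (x : R * R) : (R * R) * (R * R) :=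
  (circle_point (pc x), circle_point (sc x / n%:R)).

Lemma quotient_embeds_in_torus : embeds_in R Qn (torus R).
Proof.
have nR0 : n%:R != 0 :> R by rewrite pnatr_eq0 -lt0n.
have mulnK k : (n%:Z * k)%:~R / n%:R = k%:~R :> R by rewrite intrM mulrC mulKf.
exists (@periodic_drawing R Qn _ quotient_lift quotient_dir torus_point); last first.
  by move=> _ [[v|e t] _ <-]; split; exact: circle_point_circle.
apply: (@periodic_drawing_embedding R S Qn _ quotient_phi) => //.
- exact: quotient_liftK.
- exact: quotient_arrow_uniq.
- move=> E u /quotient_arrow_lift[e <- ue]; by rewrite quotient_dir_pi; exists e.
- move=> E u /quotient_arrow_lift[e <- ue]; rewrite quotient_dir_pi quotient_target.
  by rewrite /quotient_phi (phi_lift_target ue).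
- apply: continuous_pair => x; apply: continuous_comp;
    try exact: circle_point_continuous; first exact: period_coord_continuous.
  by apply: cvgM; [exact: strip_coord_continuous | exact: cvg_cst].
- move=> u v /quotient_phi_eqP[k [m uv]]; rewrite /torus_point.
  have [[j ->] ->] := @coords_of_congruent R S xi zeta g g' xiE zetaE u v _ m uv.
  by rewrite mulrDl mulnK !circle_pointDz.
- move=> x y xy; have /circle_point_eq[j yj] := congr1 fst xy.
  have /circle_point_eq[k yk] := congr1 snd xy.
  have [|v yv [m vm]] := lattice_of_coords xiE (k := n%:Z * k) yj.
    by apply: (mulIf (invr_neq0 nR0)); rewrite mulrDl mulnK; exact: yk.
  exists v => // u; apply/quotient_phi_eqP; exists k, m.
  by rewrite unfold_vecD vm addrA.
(* With finitely many vertices in all, local finiteness needs no smaller neighbourhood. *)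
move=> y; exists setT; first exact: filterT.
exact: sub_finite_set finite_quotient_vertices.
Qed.

End QuotientQuiver.

Theorem proposition12p6 (R : realType) (S : Ypin) :
  [/\ no_crossing (unfolded_quiver S) (lattice_point R),
      straight_line_embedding (unfolded_quiver S) (lattice_point R),
      embeds_in R (strip_quiver S) (cylinder R)
    & forall n : nat, (1 <= n)%N -> embeds_in R (quotient_quiver S n) (torus R)].
Proof.
have [xi [g xiE]] := unfold_vec_onto S (1, 0).
have [zeta [g' zetaE]] := unfold_vec_onto S (0, 1).
split.
- exact: unfolded_no_crossing.
- exact: unfolded_straight_line_embedding.
- exact: strip_embeds_in_cylinder xiE zetaE.
- by move=> n n_gt0; exact: quotient_embeds_in_torus xiE zetaE n_gt0.
Qed.
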